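(* Let $G$ be a graph with $n$ vertices and maximum degree $\Delta(G)$, and let $\lambda\in\mathbb{N}$. Then for all $p$ with $0\le p\le\lambda^{-1}$, $$\mathrm{FC}_{\lambda}(G;p)\ \ge\ P(G;\lambda)\,p^{n}.$$ Furthermore, if $\lambda>\Delta(G)+1$ then $$\mathrm{FC}_{\lambda}(G;p)=P(G;\lambda)\,p^{n}.$$
   Context: All graphs are finite and simple, with nonempty vertex set. $\mathbb{N}=\{1,2,\dots\}$, $[\lambda]=\{1,\dots,\lambda\}$, $N_G(v)$ is the set of neighbours of $v$, and $P(G;\lambda)$ is the chromatic polynomial, i.e. the number of $\lambda$-colourings of $G$. A partial $\lambda$-assignment of $G=(V,E)$ is a function $f:W\to[\lambda]$ with $W\subseteq V$; write $\operatorname{dom} f=W$ ($W=\emptyset$ and $W=V$ are allowed). It is total if $\operatorname{dom} f=V$. A $\lambda$-colouring of $G$ is a total $\lambda$-assignment in which adjacent vertices have different colours. A vertex $v\notin\operatorname{dom} f$ is immediately $\lambda$-forced by $f$ if $|\{f(w): w\in N_G(v)\cap\operatorname{dom} f\}|=\lambda-1$; in that case $f;v$ denotes the extension of $f$ to $(\operatorname{dom} f)\cup\{v\}$ that gives $v$ the unique colour of $[\lambda]$ not appearing on its neighbours in $\operatorname{dom} f$. We say $f$ ($\lambda$-)forces a $\lambda$-colouring of $G$ if there is a (possibly empty) sequence of such steps $f=f_0$, $f_i=f_{i-1};v_i$ ($1\le i\le k$, $v_i$ immediately $\lambda$-forced by $f_{i-1}$) with $f_k$ a $\lambda$-colouring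 of $G$. For $C\subseteq V$, $\mathrm{fcol}(G,C;\lambda)$ is the number of partial $\lambda$-assignments $f$ with $\operatorname{dom} f=C$ that force a $\lambda$-colouring of $G$. The forced $\lambda$-colouring polynomial is the polynomial in $p$ $$\mathrm{FC}_{\lambda}(G;p)=\sum_{C\subseteq V}\mathrm{fcol}(G,C;\lambda)\,p^{|C|}(1-\lambda p)^{n-|C|},\qquad n=|V|.$$ For $0\le p\le\lambda^{-1}$ this is the probability that a random partial $\lambda$-assignment forces a $\lambda$-colouring of $G$, where independently each vertex receives each particular colour with probability $p$ and remains uncoloured with probability $1-\lambda p$. *)

(* Defs.v *)
From HB Require Import structures.
From mathcomp Require Import all_boot all_order all_algebra.

Set Implicit Arguments.
Unset Strict Implicit.
Unset Printing Implicit Defensive.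

Import Order.TTheory GRing.Theory Num.Theory.

Record sgraph := SGraph {
  vertex :> finType;
  adj : rel vertex;
  adj_sym : symmetric adj;
  adj_irrefl : irreflexive adj;
  vertex_nonempty : 0 < #|vertex| }.

Definition neighbours (G : sgraph) (v : G) : {set G} := [set w | adj v w].

Definition max_degree (G : sgraph) : nat := \max_(v : G) #|neighbours v|.

(* The colours are 'I_l, i.e. 0, ..., l - 1 instead of 1, ..., l; the value
   None means that the vertex is not in the domain. *)
Definition passign (G : sgraph) (l : nat) := {ffun G -> option 'I_l}.

Definition dom (G : sgraph) (l : nat) (f : passign G l) : {set G} :=
  [set v | f v != None].

Definition is_colouring (G : sgraph) (l : nat) (f : passign G l) : bool :=
  (dom f == [set: G]) && [forall v, forall w, adj v w ==> (f v != f w)].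

(* Number of proper colourings with l colours, i.e. the value at l of the
   chromatic polynomial. *)
Definition chromatic (G : sgraph) (l : nat) : nat :=
  #|[set f : passign G l | is_colouring f]|.

Definition neighbour_colours (G : sgraph) (l : nat) (f : passign G l) (v : G) :
    {set 'I_l} :=
  [set c | [exists w in neighbours v, f w == Some c]].

Definition immediately_forced (G : sgraph) (l : nat) (f : passign G l) (v : G) :
    bool :=
  (v \notin dom f) && (#|neighbour_colours f v| == l.-1).

(* When v is immediately forced by f and l > 0, exactly one colour is missing
   from neighbour_colours f v, so that the pick below is Some of that colour. *)
Definition extend (G : sgraph) (l : nat) (f : passign G l) (v : G) :
    passign G l :=
  [ffun w => if w == v then [pick c | c \notin neighbour_colours f v]
             else f w].

Definition force_step (G : sgraph) (l : nat) : rel (passign G l) :=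
  [rel f g | [exists v, immediately_forced f v && (g == extend f v)]].

Definition forces_colouring (G : sgraph) (l : nat) (f : passign G l) : bool :=
  [exists g, connect (@force_step G l) f g && is_colouring g].

Definition fcol (G : sgraph) (C : {set G}) (l : nat) : nat :=
  #|[set f : passign G l | (dom f == C) && forces_colouring f]|.

Local Open Scope ring_scope.

Definition FC (R : nzRingType) (l : nat) (G : sgraph) : {poly R} :=
  \sum_(C : {set G})
    (fcol C l)%:R *: ('X ^+ #|C| * (1 - l%:R *: 'X) ^+ (#|G| - #|C|)).

(* Main.v *)
Require Import Defs.
From mathcomp Require Import all_boot all_order all_algebra.

Import Order.TTheory GRing.Theory Num.Theory.
Local Open Scope ring_scope.

(** The inequality keeps only the term [C = V] of the sum defining [FC].  A
total assignment admits no forcing step, so it forces a colouring exactly when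
it is one ([fcol_setT]); the term is therefore the chromatic polynomial times
[p ^ n].  The other terms are nonnegative when [0 <= p <= 1 / l].

A forcing step at [v] needs [l - 1] distinct colours on the neighbours of [v],
hence degree at least [l - 1].  When the maximum degree is below [l - 1] no
assignment admits a step, so only colourings force colourings, and these are
total: every term with [C <> V] vanishes ([fcol_eq0]).

Both halves thus rest on [forces_colouring_stuck], which describes the
assignments from which no step is possible. *)

(** The only forcing sequence that starts at such an [f] is the empty one. *)
Lemma forces_colouring_stuck (G : sgraph) (l : nat) (f : passign G l) :
  (forall v, ~~ immediately_forced f v) -> forces_colouring f = is_colouring f.
Proof.
move=> stuck; apply/existsP/idP => [[g /andP[/connectP[[|h s] /= fs ->]]] // | colf].
  by case/andP: fs => /existsP[v /andP[]]; rewrite (negbTE (stuck v)).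
by exists f; rewrite connect0.
Qed.

Lemma fcol_setT (G : sgraph) (l : nat) : fcol [set: G] l = chromatic G l.
Proof.
apply: eq_card => f; rewrite !inE.
have [domf | /negbTE domf] := boolP (dom f == _); last by rewrite /is_colouring domf.
rewrite forces_colouring_stuck // => v.
by rewrite /immediately_forced (eqP domf) in_setT.
Qed.

Lemma card_neighbour_colours (G : sgraph) (l : nat) (f : passign G l) (v : G) :
  (#|neighbour_colours f v| <= #|neighbours v|)%N.
Proof.
rewrite -(card_imset _ Some_inj); apply: leq_trans (leq_imset_card f _).
apply/subset_leq_card/subsetP => _ /imsetP[c + ->].
by rewrite inE => /existsP[w /andP[vw /eqP<-]]; apply: imset_f.
Qed.

(** Forcing would require [l - 1] distinct colours around [v], more than the
number of its neighbours. *)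
Lemma not_forced_max_degree (G : sgraph) (l : nat) (f : passign G l) (v : G) :
  (max_degree G + 1 < l)%N -> ~~ immediately_forced f v.
Proof.
move=> ltl; rewrite negb_and orbC neq_ltn (leq_ltn_trans (card_neighbour_colours _ _ f v)) //.
apply: (@leq_ltn_trans (max_degree G)); first exact: leq_bigmax.
by rewrite ltn_predRL -addn1.
Qed.

Lemma fcol_eq0 (G : sgraph) (l : nat) (C : {set G}) :
  (max_degree G + 1 < l)%N -> C != [set: G] -> fcol C l = 0%N.
Proof.
move=> ltl CnT; apply: eq_card0 => f; rewrite !inE.
rewrite forces_colouring_stuck => [|v]; last exact: not_forced_max_degree.
by apply: contraNF CnT => /andP[/eqP<- /andP[]].
Qed.

(** Splitting off the term [C = V] serves both halves: the remaining sum is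
nonnegative in one and zero in the other. *)
Lemma FC_setT (R : nzRingType) (G : sgraph) (l : nat) :
  FC R l G = (chromatic G l)%:R *: 'X^#|G| +
    \sum_(C : {set G} | C != [set: G])
      (fcol C l)%:R *: ('X ^+ #|C| * (1 - l%:R *: 'X) ^+ (#|G| - #|C|)).
Proof.
by rewrite /FC (bigD1 [set: G]) //= fcol_setT cardsT subnn expr0 mulr1.
Qed.

Theorem proposition5 (R : realFieldType) (G : sgraph) (l : nat)
    (hl : (0 < l)%N) :
  (forall p : R, 0 <= p -> p <= l%:R^-1 ->
     (FC R l G).[p] >= (chromatic G l)%:R * p ^+ #|G|) /\
  ((l > max_degree G + 1)%N ->
     FC R l G = (chromatic G l)%:R *: 'X^#|G|).
Proof.
split=> [p p0 ple | ltl]; rewrite FC_setT.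
  have lp1 : 0 <= 1 - l%:R * p.
    by rewrite subr_ge0 mulrC -ler_pdivlMr ?ltr0n // mul1r.
  rewrite hornerD hornerZ hornerXn lerDl horner_sum sumr_ge0 // => C _.
  by rewrite !(hornerE, horner_exp) !mulr_ge0 ?exprn_ge0.
by rewrite big1 ?addr0 // => C CnT; rewrite fcol_eq0 // scale0r.
Qed.
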